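(* The polymodal provability logic $\mathsf{GLP}$ is sound for poly-provability $\mathsf{GLP}$-models: if $\mathsf{GLP}\vdash A$ and $\mathcal P$ is a poly-provability $\mathsf{GLP}$-model, then $\mathcal P,w\Vdash A$ for every world $w$ of $\mathcal P$.
   Context: Language $\mathcal L_\omega$: formulas built from atomic propositions and $\bot$ using $\to$ and unary modal operators $[n]$ for each $n\in\mathbb N$. Purely modal: Boolean combination of formulas $[n]B$. $\mathsf{GLP}$ has modus ponens as only rule and axioms: classical tautologies; $[n](A\to B)\to([n]A\to[n]B)$; $[n]A\to[n][n]A$; $[n]([n]A\to A)\to[n]A$; $[n]A\to[n+1]A$; $\neg[n]A\to[n+1]\neg[n]A$; and $[0]X$ for $X$ any of these axioms. A theory is a pair of a set of axioms and a set of inference rules (finitely many premises, one conclusion); $\mathsf T\vdash A$ means derivability; $\mathsf T\subseteq\mathsf T'$ means every theorem of $\mathsf T$ is a theorem of $\mathsf T'$. A poly-provability pre-model is $\mathcal P=(W,\{\sqsubset_n\}_{n\in\mathbb N},\{L^n_w\}_{n\in\mathbb N,w},V)$ with $W$ nonempty, each $\sqsubset_n$ a binary relation on $W$, $V\subseteq W\times\mathrm{atoms}$, and a theory $L^n_w$ for each $n$ and each $w\in W^{\sqsubset_0}=\{u:\exists v\,(v\sqsubset_0u)\}$. Satisfaction: atoms via $V$, $\bot$ never holds, $\to$ classical, $\mathcal P,w\Vdash[n]B$ iff $L^n_u\vdash B$ for all $u$ with $w\sqsubset_n u$. $\mathcal P,w\Vdash^+_0A$ iff $\mathcal P,u\Vdash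 A$ for every $u$ reachable from $w$ by a finite (possibly empty) chain of $\sqsubset_0$-steps. $\mathcal P$ is a poly-provability model if for all $n$ and $w\in W^{\sqsubset_0}$: $L^n_w$ is classical (all classical tautologies derivable, modus ponens a rule), and modal completeness holds: for purely modal $A$, $\mathcal P,w\Vdash^+_0A$ implies $L^0_w\vdash A$. It is a poly-provability $\mathsf{GLP}$-model if moreover: each $L^n_w$ has the rule ''from $A$ infer $[n]A$'' and the rule ''from $[n]A\to A$ infer $A$''; ascending: $\sqsubset_{n+1}\subseteq\sqsubset_n$ and $L^n_w\subseteq L^{n+1}_w$; $\Pi$-completeness: if $u\sqsubset_{n+1}w$ and $\mathcal P,u\Vdash\neg[n]A$ then $L^{n+1}_w\vdash\neg[n]A$. *)

(* Defs.v *)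
From Stdlib Require Import List Relations Bool.
Import ListNotations.

Inductive form (atom : Type) : Type :=
| Atom : atom -> form atom
| Bot : form atom
| Imp : form atom -> form atom -> form atom
| Box : nat -> form atom -> form atom.

Arguments Atom {atom} _.
Arguments Bot {atom}.
Arguments Imp {atom} _ _.
Arguments Box {atom} _ _.

Declare Scope form_scope.
Delimit Scope form_scope with form.
Bind Scope form_scope with form.
Infix "~>" := Imp (at level 55, right associativity) : form_scope.
Open Scope form_scope.

Definition Neg {atom : Type} (A : form atom) : form atom := A ~> Bot.

Inductive purely_modal {atom : Type} : form atom -> Prop :=
| pm_bot : purely_modal Bot
| pm_box : forall n A, purely_modal (Box n A)
| pm_imp : forall A B,
    purely_modal A -> purely_modal B -> purely_modal (A ~> B).

(* Propositional evaluation: atoms and boxed formulas are the independent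
   propositional letters. *)
Fixpoint peval {atom : Type} (va : atom -> bool) (vb : nat -> form atom -> bool)
    (A : form atom) : bool :=
  match A with
  | Atom p => va p
  | Bot => false
  | B ~> C => implb (peval va vb B) (peval va vb C)
  | Box n B => vb n B
  end.

Definition tautology {atom : Type} (A : form atom) : Prop :=
  forall va vb, peval va vb A = true.

(* A set of inference rules is given by the set of its instances
   (list of premises, conclusion). *)
Record theory (atom : Type) : Type := Theory {
  thy_axiom : form atom -> Prop;
  thy_rule : list (form atom) -> form atom -> Prop
}.

Arguments Theory {atom} _ _.
Arguments thy_axiom {atom} _ _.
Arguments thy_rule {atom} _ _ _.

Inductive derives {atom : Type} (T : theory atom) : form atom -> Prop :=
| derives_axiom : forall A, thy_axiom T A -> derives T A
| derives_rule : forall Gamma A,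
    thy_rule T Gamma A -> (forall B, In B Gamma -> derives T B) -> derives T A.

Definition subtheory {atom : Type} (T T' : theory atom) : Prop :=
  forall A, derives T A -> derives T' A.

Inductive mp_rule {atom : Type} : list (form atom) -> form atom -> Prop :=
| mp_intro : forall A B, mp_rule [A; A ~> B] B.

Inductive glp_base {atom : Type} : form atom -> Prop :=
| glp_taut : forall A, tautology A -> glp_base A
| glp_K : forall n A B,
    glp_base (Box n (A ~> B) ~> Box n A ~> Box n B)
| glp_4 : forall n A, glp_base (Box n A ~> Box n (Box n A))
| glp_Lob : forall n A, glp_base (Box n (Box n A ~> A) ~> Box n A)
| glp_mono : forall n A, glp_base (Box n A ~> Box (S n) A)
| glp_neg : forall n A,
    glp_base (Neg (Box n A) ~> Box (S n) (Neg (Box n A))).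

Inductive glp_axiom {atom : Type} : form atom -> Prop :=
| glp_axiom_base : forall A, glp_base A -> glp_axiom A
| glp_axiom_box0 : forall A, glp_base A -> glp_axiom (Box 0 A).

Definition GLP (atom : Type) : theory atom := Theory glp_axiom mp_rule.

(* pm_thy is total; every condition below constrains it only at worlds having a
   0-predecessor, so its values elsewhere are arbitrary.  In a GLP-model all
   relations are contained in the 0-relation, so [sat] never consults them. *)
Record premodel (atom : Type) : Type := Premodel {
  pm_world : Type;
  pm_world_nonempty : inhabited pm_world;
  pm_rel : nat -> pm_world -> pm_world -> Prop;
  pm_thy : nat -> pm_world -> theory atom;
  pm_val : pm_world -> atom -> Prop
}.

Arguments pm_world {atom} _.
Arguments pm_rel {atom} _ _ _ _.
Arguments pm_thy {atom} _ _ _.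
Arguments pm_val {atom} _ _ _.

Definition has_pred0 {atom : Type} (P : premodel atom) (w : pm_world P) : Prop :=
  exists v, pm_rel P 0 v w.

Fixpoint sat {atom : Type} (P : premodel atom) (w : pm_world P)
    (A : form atom) : Prop :=
  match A with
  | Atom p => pm_val P w p
  | Bot => False
  | B ~> C => sat P w B -> sat P w C
  | Box n B => forall u, pm_rel P n w u -> derives (pm_thy P n u) B
  end.

Definition sat_plus0 {atom : Type} (P : premodel atom) (w : pm_world P)
    (A : form atom) : Prop :=
  forall u, clos_refl_trans (pm_world P) (pm_rel P 0) w u -> sat P u A.

Definition classical_theory {atom : Type} (T : theory atom) : Prop :=
  (forall A, tautology A -> derives T A) /\
  (forall A B, thy_rule T [A; A ~> B] B).

Record poly_provability_model {atom : Type} (P : premodel atom) : Prop := {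
  ppm_classical : forall n w, has_pred0 P w -> classical_theory (pm_thy P n w);
  ppm_modal_completeness : forall w, has_pred0 P w ->
    forall A, purely_modal A -> sat_plus0 P w A -> derives (pm_thy P 0 w) A
}.

Record poly_provability_GLP_model {atom : Type} (P : premodel atom) : Prop := {
  glpm_model : poly_provability_model P;
  glpm_nec : forall n w, has_pred0 P w ->
    forall A, thy_rule (pm_thy P n w) [A] (Box n A);
  glpm_lob : forall n w, has_pred0 P w ->
    forall A, thy_rule (pm_thy P n w) [Box n A ~> A] A;
  glpm_rel_ascending : forall n u w, pm_rel P (S n) u w -> pm_rel P n u w;
  glpm_thy_ascending : forall n w, has_pred0 P w ->
    subtheory (pm_thy P n w) (pm_thy P (S n) w);
  glpm_Pi_completeness : forall n u w A, pm_rel P (S n) u w ->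
    sat P u (Neg (Box n A)) -> derives (pm_thy P (S n) w) (Neg (Box n A))
}.

(* Main.v *)
From Stdlib Require Import List ClassicalEpsilon.
Require Import Defs.

(** Every base axiom of GLP holds at every world: each scheme is the reflection
    of one closure condition on the theories [L^n_w].  A base axiom is either a
    tautology or purely modal; in the latter case its validity everywhere and
    modal completeness make it derivable in every [L^0_w], so its [[0]]-boxing
    is valid too. *)

Lemma derives_mp {atom : Type} (T : theory atom) (A B : form atom) :
  classical_theory T -> derives T A -> derives T (A ~> B) -> derives T B.
Proof.
  intros [_ Hmp] HA HAB.
  apply (derives_rule T _ _ (Hmp A B)).
  intros C [<- | [<- | []]]; assumption.
Qed.

Lemma derives_unary {atom : Type} (T : theory atom) (A B : form atom) :
  thy_rule T (A :: nil) B -> derives T A -> derives T B.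
Proof.
  intros Hr HA. apply (derives_rule T _ _ Hr).
  intros C [<- | []]; assumption.
Qed.

(** Classical decision bridging [sat], valued in [Prop], and the boolean valuations quantified over
    in [tautology]. *)
Definition truthb (Q : Prop) : bool :=
  if excluded_middle_informative Q then true else false.

Lemma truthb_true (Q : Prop) : truthb Q = true <-> Q.
Proof.
  unfold truthb. destruct (excluded_middle_informative Q); split; easy.
Qed.

(** At a fixed world, satisfaction is itself a propositional valuation: boxed formulas serve as
    letters and [~>] is read classically. *)
Lemma peval_sat {atom : Type} (P : premodel atom) (w : pm_world P)
    (A : form atom) :
  peval (fun p => truthb (sat P w (Atom p)))
        (fun n B => truthb (sat P w (Box n B))) A = true <-> sat P w A.
Proof.
  induction A as [p | | A IHA B IHB | n A _].
  - apply truthb_true.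
  - easy.
  - cbn [peval sat]. rewrite <- IHA, <- IHB, Bool.implb_true_iff. reflexivity.
  - apply truthb_true.
Qed.

Lemma tautology_sat {atom : Type} (P : premodel atom) (w : pm_world P)
    (A : form atom) :
  tautology A -> sat P w A.
Proof. intros HA. apply peval_sat, HA. Qed.

Lemma glp_base_tautology_or_modal {atom : Type} (A : form atom) :
  glp_base A -> tautology A \/ purely_modal A.
Proof.
  intros [B HB | | | | | ]; [left; exact HB | right ..];
    repeat constructor.
Qed.

Section GLPModel.

Context {atom : Type} {P : premodel atom} (HP : poly_provability_GLP_model P).

(** Each [n]-step is also a [0]-step, so the model conditions apply to every theory that the truth
    of a box refers to. *)
Lemma rel_has_pred0 (n : nat) (w u : pm_world P) :
  pm_rel P n w u -> has_pred0 P u.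
Proof.
  induction n as [| n IH]; intros H.
  - exists w. exact H.
  - apply IH, (glpm_rel_ascending P HP), H.
Qed.

Lemma glp_base_sat (A : form atom) :
  glp_base A -> forall w : pm_world P, sat P w A.
Proof.
  intros [B HB | n B C | n B | n B | n B | n B] w.
  - apply tautology_sat, HB.
  - intros HBC HB u Hu. apply (derives_mp _ B); auto.
    apply (ppm_classical P (glpm_model P HP)), (rel_has_pred0 n w u Hu).
  - intros HB u Hu. apply (derives_unary _ B); auto.
    apply (glpm_nec P HP), (rel_has_pred0 n w u Hu).
  - intros HB u Hu. apply (derives_unary _ (Box n B ~> B)); auto.
    apply (glpm_lob P HP), (rel_has_pred0 n w u Hu).
  - intros HB u Hu.
    (* Both inclusions are used: the step [Hu] is lowered to index [n], and the derivation found
       there is lifted to index [S n]. *)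
    apply (glpm_thy_ascending P HP n u (rel_has_pred0 _ w u Hu)).
    apply HB, (glpm_rel_ascending P HP), Hu.
  - intros HB u Hu. apply (glpm_Pi_completeness P HP n w u B Hu HB).
Qed.

Lemma glp_axiom_sat (A : form atom) :
  glp_axiom A -> forall w : pm_world P, sat P w A.
Proof.
  intros [B HB | B HB] w; [apply glp_base_sat, HB |].
  intros u Hu. pose proof (rel_has_pred0 0 w u Hu) as Hp.
  (* A tautology may have atoms outside boxes, where modal completeness says nothing; classicality
     of the theory covers that case. *)
  destruct (glp_base_tautology_or_modal B HB) as [Ht | Hm].
  - apply (ppm_classical P (glpm_model P HP) 0 u Hp), Ht.
  - apply (ppm_modal_completeness P (glpm_model P HP) u Hp B Hm).
    intros v _. apply glp_base_sat, HB.
Qed.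

End GLPModel.

Theorem theorem6p2 (atom : Type) (A : form atom) (P : premodel atom) :
  derives (GLP atom) A -> poly_provability_GLP_model P ->
  forall w : pm_world P, sat P w A.
Proof.
  intros HA HP w.
  induction HA as [A HA | Gamma A HR _ IH].
  - apply (glp_axiom_sat HP), HA.
  - destruct HR as [A B].
    (* Modus ponens is function application, since [sat] reads [~>] as implication. *)
    apply (IH (A ~> B)); [right; left | apply IH; left]; reflexivity.
Qed.
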